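(* For every integer $d\ge 1$ and all positive integers $\ell_1,\ldots,\ell_d$, the independence polynomial of the spider $S(\ell_1,\ldots,\ell_d)$ satisfies $$I\bigl(S(\ell_1,\ldots,\ell_d),z\bigr)\neq 0\qquad\text{for every } z\in\mathbb C \text{ with } \operatorname{Re} z\ge 0.$$ Hence every independence root of a spider has strictly negative real part, and thus every spider is stable.
   Context: All graphs are finite and simple. For a graph $G$, let $i_k(G)$ denote the number of independent sets of $G$ of cardinality $k$ (so $i_0(G)=1$), and let $\alpha(G)$ be the independence number. The independence polynomial of $G$ is $I(G,z)=\sum_{k=0}^{\alpha(G)} i_k(G)z^k$, and its complex zeros are called the independence roots of $G$. A polynomial is called stable if all of its zeros lie in the closed left half-plane $\{z\in\mathbb C:\operatorname{Re} z\le 0\}$; a graph is called stable if its independence polynomial is stable. For $d\ge1$ and positive integers $\ell_1,\ldots,\ell_d$, the spider $S(\ell_1,\ldots,\ell_d)$ is the tree with a distinguished central vertex $c$ such that deleting $c$ leaves $d$ pairwise disjoint paths $P_{\ell_1},\ldots,P_{\ell_d}$, where $P_n$ denotes the path on $n$ vertices and $c$ is adjacent to exactly one vertex of each of these paths, namely an end vertex of it. Thus the $j$th leg has $\ell_j$ edges from $c$ to its leaf. *)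

(* Defs.v *)
From HB Require Import structures.
From mathcomp Require Import all_boot all_order all_algebra.
From mathcomp Require Import reals.
From mathcomp.real_closed Require Import complex.

Set Implicit Arguments.
Unset Strict Implicit.
Unset Printing Implicit Defensive.

Import Order.TTheory GRing.Theory Num.Theory.

Local Open Scope ring_scope.

Record sgraph := SGraph {
  vertex :> finType;
  adj : rel vertex;
  adj_sym : symmetric adj;
  adj_irr : irreflexive adj
}.

Section IndependencePolynomial.
Variable G : sgraph.

Definition independent (A : {set G}) : bool :=
  [forall x in A, forall y in A, ~~ adj x y].

Definition num_indep (k : nat) : nat :=
  #|[set A : {set G} | independent A & #|A| == k]|.

Definition indep_number : nat := (\max_(A : {set G} | independent A) #|A|)%N.

Definition indep_poly (K : nzRingType) : {poly K} :=
  \sum_(k < indep_number.+1) (num_indep k)%:R *: 'X^k.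

End IndependencePolynomial.

Definition stable_poly (R : realType) (p : {poly R[i]}) : Prop :=
  forall z : R[i], root p z -> complex.Re z <= 0.

Definition stable_graph (R : realType) (G : sgraph) : Prop :=
  stable_poly (indep_poly G R[i]).

Section Spider.
Variables (d : nat) (l : 'I_d -> nat).

(* [None] is the centre; [Some (Tagged _ i)] with [i : 'I_(l j)] is the vertex
   of leg [j] at distance [i.+1] from the centre. *)
Definition spider_vertex : finType := option {j : 'I_d & 'I_(l j)}.

Definition spider_adj (x y : spider_vertex) : bool :=
  match x, y with
  | None, None => false
  | None, Some u | Some u, None => tagged u == 0%N :> nat
  | Some u, Some v =>
      (tag u == tag v) &&
      (((tagged u).+1 == tagged v :> nat) || ((tagged v).+1 == tagged u :> nat))
  end.

Lemma spider_adj_sym : symmetric spider_adj.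
Proof. by case=> [u|] [v|] //=; rewrite eq_sym orbC. Qed.

Lemma spider_adj_irr : irreflexive spider_adj.
Proof. by case=> [u|] //=; rewrite eqxx orbb gtn_eqF. Qed.

Definition spider : sgraph := SGraph spider_adj_sym spider_adj_irr.

End Spider.

(* Main.v *)
Require Import Defs.
From mathcomp Require Import all_boot all_order all_algebra.
From mathcomp Require Import reals.
From mathcomp.real_closed Require Import complex.
From mathcomp Require Import ring lra zify.

Set Implicit Arguments.
Unset Strict Implicit.

Import Order.TTheory GRing.Theory Num.Theory.
Import Normc.

Local Open Scope ring_scope.

(** Write F_n for the independence polynomial of the path on n vertices.
    Deciding whether the centre is taken gives
      I(S(l_1, ..., l_d)) = prod_j F_(l_j) + z prod_j F_(l_j - 1)
    ([spider_sum]).  The ratios u_n = F_n / F_(n-1) obey u_0 = 1 and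
    u_(n+1) = 1 + z / u_n, so a root z at which no F_n vanishes is a solution of
      prod_j u_(l_j) = - z.
    Roots come in conjugate pairs, so z may be taken in the closed first
    quadrant, and z = 0 is clearly no root; put r = |z|.

    Every u_n has real part at least 1, so that no F_n vanishes, and an argument
    between 0 and arg z ([path_ratio_wedge]).  Each factor therefore turns the
    product by at most arg z, while the argument of - z is pi + arg z.  Multiply
    the factors one by one until the product first leaves the quadrant Re > 0,
    Im >= 0; at that moment its argument is at most pi / 2 + arg z, so the
    remaining factors still turn by pi / 2 or more, and their product lies
    outside the quadrant too ([prod_admissible_neq]).  It remains to see that
    leaving the quadrant costs a modulus larger than the square root of r
    ([exit_normc_sqr]): then |prod_j u_(l_j)| > r = |- z|, a contradiction.

    The cost of an exit rests on two estimates for u = u_n with n > 0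
    ([path_ratio_bounds]).  First, sin (arg u) <= sqrt 2 |u|^2 / r: a ratio that
    turns the product much is large.  Second, |u|^2 >= (2 + 3 r^2) / (2 + r^2).
    If the partial product P is inside the quadrant and P u is outside, then
    sin (arg P) + sin (arg u) >= 1 ([quadrant_exit]).  As sines are subadditive
    and a sum of numbers that are at least 2 is at most their product, the first
    estimate, with sqrt 2 relaxed to 10 / 7, passes from the factors to P when
    all |u|^2 are at least 20 / 7 ([slim_prod]), and gives
    1 <= (10 / 7) (|P|^2 + |u|^2) / r < |P|^2 |u|^2 / r.  The second estimate
    provides these lower bounds when r > 6.  When r <= 6 it suffices alone,
    because an exit takes at least two factors.

    Both estimates are obtained from the double step
    u -> 1 + z / (1 + z / u) = 1 + u / (1 + u / z), the parities being separate
    because u_n looks like n / 2 + 1 for even n and like 2 z / (n + 1) for odd n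
    when z is large.  The sine estimate alone is not preserved where arg u is
    near pi / 2, so it is carried along with tan (arg u) <= 3 |u|^2 / r. *)

(** * Independence polynomial of a spider *)

Section IndependentSubsets.
Variables (G : sgraph) (K : comNzRingType) (z : K).
Implicit Types (U V A : {set G}) (v x y : G).

(** Independent sets inside U, that is, the independence polynomial of the
    subgraph induced on U; varying U inside the fixed vertex type of G replaces
    the deletion of vertices from graphs. *)
Definition indep_sum U : K := \sum_(A : {set G} | independent A && (A \subset U)) z ^+ #|A|.

Lemma indep_polyE : (indep_poly G K).[z] = indep_sum setT.
Proof.
rewrite /indep_poly horner_sum /indep_sum.
rewrite (partition_big (fun A : {set G} => inord #|A| : 'I_(indep_number G).+1) predT) //=.
apply: eq_bigr => k _; rewrite hornerZ hornerXn /num_indep -sum1_card natr_sum mulr_suml.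
apply: congr_big => // A; last first.
  by rewrite inE => /andP[_ /eqP ->]; rewrite mul1r.
rewrite inE subsetT andbT; case: (boolP (independent A)) => //= iA.
have lt : (#|A| < (indep_number G).+1)%N by rewrite ltnS; apply: leq_bigmax_cond.
by rewrite -val_eqE /= inordK.
Qed.

Lemma independentP A :
  reflect {in A &, forall x y, ~~ adj x y} (independent A).
Proof.
apply: (iffP forall_inP) => [h x y xA yA|h x xA].
  by move/forall_inP: (h x xA) => /(_ y yA).
by apply/forall_inP => y; apply: h.
Qed.

Lemma indep_sum0 : indep_sum set0 = 1.
Proof.
rewrite /indep_sum (big_pred1 set0) ?cards0 ?expr0 // => A /=.
rewrite subset0; apply: andb_idl => /eqP ->.
by apply/independentP => x y; rewrite inE.
Qed.

(** The two terms count the independent sets that avoid v and those that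
    contain it, the latter through the bijection removing v. *)
Lemma indep_sum_vertex v U : v \in U ->
  indep_sum U = indep_sum (U :\ v)
                + z * indep_sum [set x in U | (x != v) && ~~ adj v x].
Proof.
move=> vU; rewrite /indep_sum (bigID (fun A => v \notin A)) /=; congr (_ + _).
  by apply: eq_bigl => A; rewrite subsetD1 andbA.
rewrite mulr_sumr (reindex_onto (fun A => v |: A) (fun A => A :\ v)) /=; last first.
  by move=> A /andP[_]; rewrite negbK => vA; rewrite setD1K.
apply: congr_big => // A; last first.
  move=> /andP[_ /eqP eA]; have vA : v \notin A by rewrite -eA setD11.
  by rewrite cardsU1 vA exprS.
rewrite negbK setU11 andbT.
apply/idP/idP => [/andP[/andP[iA sA] /eqP eA]|/andP[iA sA]].
  have vA : v \notin A by rewrite -eA setD11.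
  move/independentP: iA => iA.
  apply/andP; split.
    by apply/independentP => x y xA yA; apply: iA; rewrite inE (xA, yA) orbT.
  apply/subsetP => x xA; rewrite inE (subsetP sA) ?inE ?xA ?orbT //=.
  apply/andP; split; first by apply: contraNneq vA => <-.
  by apply: iA; rewrite !inE ?eqxx ?xA ?orbT.
have {}sA x : x \in A -> [&& x \in U, x != v & ~~ adj v x].
  by move=> xA; have := subsetP sA x xA; rewrite inE.
have vA : v \notin A by apply/negP => /sA; rewrite eqxx andbF.
rewrite setU1K // eqxx andbT; apply/andP; split; last first.
  by rewrite subUset sub1set vU; apply/subsetP => x /sA /andP[].
move/independentP: iA => iA; apply/independentP => x y; rewrite !inE.
case/predU1P => [->|xA] /predU1P[->|yA].
- by rewrite adj_irr.
- by case/and3P: (sA y yA).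
- by rewrite adj_sym; case/and3P: (sA x xA).
- exact: iA.
Qed.

(** Both sides satisfy the recursion of [indep_sum_vertex] at a vertex of U,
    because such a vertex has no neighbour in V. *)
Lemma indep_sumU U V : [disjoint U & V] ->
  {in U & V, forall x y, ~~ adj x y} ->
  indep_sum (U :|: V) = indep_sum U * indep_sum V.
Proof.
have [n] := ubnP #|U|; elim: n U => // n IHn U ltUn dUV nUV.
have [->|[v vU]] := set_0Vmem U; first by rewrite set0U indep_sum0 mul1r.
have vV : v \notin V by rewrite (disjointFr dUV vU).
have sub (W : {set G}) : W \subset U :\ v -> indep_sum (W :|: V) = indep_sum W * indep_sum V.
  move=> sW; have sWU : W \subset U := subset_trans sW (subD1set _ _).
  apply: IHn; first by rewrite (leq_ltn_trans (subset_leq_card sW)) //;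
    move: ltUn; rewrite (cardsD1 v) vU.
    exact: disjointWl sWU dUV.
  by move=> x y xW; apply: nUV; apply: (subsetP sWU).
rewrite (@indep_sum_vertex v (U :|: V)) ?inE ?vU //.
rewrite (@indep_sum_vertex v U vU) mulrDl -mulrA -!sub //; last first.
  by apply/subsetP => x; rewrite !inE => /and3P[-> ->].
congr (indep_sum _ + z * indep_sum _); apply/setP => x; rewrite !inE.
  by case: eqVneq => [->|] //=; rewrite (negbTE vV).
case xV: (x \in V); last by rewrite !orbF.
rewrite !orbT /= nUV // andbT.
by apply: contraNneq vV => <-.
Qed.

End IndependentSubsets.

(** The value at z of the independence polynomial of the path on n vertices. *)
Fixpoint path_sum (K : comNzRingType) (z : K) (n : nat) : K :=
  if n is m.+1 then
    (if m is k.+1 then path_sum z m + z * path_sum z k else 1 + z)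
  else 1.

Lemma path_sumSS (K : comNzRingType) (z : K) n :
  path_sum z n.+2 = path_sum z n.+1 + z * path_sum z n.
Proof. by []. Qed.

Section SpiderSum.
Variables (d : nat) (l : 'I_d -> nat) (K : comNzRingType) (z : K).

(** What remains of the legs in s once their k vertices closest to the centre
    are deleted: k = 0 when the centre is left out of the independent set, and
    k = 1 when it is taken. *)
Definition outer_legs (s : seq 'I_d) (k : nat) : {set spider l} :=
  [set x : spider l | if x is Some v then (tag v \in s) && (k <= tagged v)%N else false].

Lemma leg_vertex_eq (u v : {j : 'I_d & 'I_(l j)}) :
  (u == v) = (tag u == tag v) && (tagged u == tagged v :> nat).
Proof.
case: u v => [i x] [j y] /=; case: (eqVneq i j) y => [<-|nij] y /=.
  by rewrite eq_Tagged.
by apply/eqP => -[/eqP]; rewrite (negbTE nij).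
Qed.

Lemma outer_leg_sum j k : (k <= l j)%N ->
  indep_sum z (outer_legs [:: j] k) = path_sum z (l j - k).
Proof.
have [n] := ubnP (l j - k); elim: n k => // n IHn k lt_n le_k.
have [lt_k|ge_k] := ltnP k (l j); last first.
  have -> : (l j - k = 0)%N by apply/eqP; rewrite subn_eq0.
  suff -> : outer_legs [:: j] k = set0 by rewrite indep_sum0.
  apply/setP => -[[i x]|]; rewrite !inE //=.
  apply/negP => /andP[/eqP ij]; have := ltn_ord x; move: (x : nat) => m.
  by rewrite ij => ml km; move: ml; rewrite ltnNge (leq_trans ge_k km).
pose v : spider l := Some (Tagged (fun i => 'I_(l i)) (Ordinal lt_k)).
rewrite (@indep_sum_vertex _ _ _ v _); last by rewrite inE /= mem_seq1 eqxx leqnn.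
have -> : outer_legs [:: j] k :\ v = outer_legs [:: j] k.+1.
  apply/setP => -[x|]; rewrite !inE //= /v (inj_eq Some_inj) leg_vertex_eq /=.
  by case: (tag x =P j) => //= _; rewrite ltn_neqAle eq_sym.
have -> : [set x in outer_legs [:: j] k | (x != v) && ~~ adj v x]
          = outer_legs [:: j] k.+2.
  apply/setP => -[x|]; rewrite !inE //= /v (inj_eq Some_inj) leg_vertex_eq /=.
  rewrite [j == _]eq_sym; case: (tag x =P j) => //= _.
  by move: (tagged x : nat) => m; lia.
have E : (l j - k = (l j - k.+1).+1)%N by rewrite subnSK.
rewrite IHn //; last by move: lt_n; rewrite E.
rewrite E; have [lt_k1|ge_k1] := ltnP k.+1 (l j).
  rewrite IHn //; last by move: lt_n; rewrite E ltnS => /ltnW; rewrite -subnSK.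
  by rewrite -[in RHS]subnSK // path_sumSS subnSK.
have -> : (l j - k.+1 = 0)%N by apply/eqP; rewrite subn_eq0.
suff -> : outer_legs [:: j] k.+2 = set0 by rewrite indep_sum0 mulr1.
apply/setP => -[[i x]|]; rewrite !inE //=.
apply/negP => /andP[/eqP ij]; have := ltn_ord x; move: (x : nat) => m.
by rewrite ij => ml km; move: ml; rewrite ltnNge ltnW // (leq_trans _ km).
Qed.

Lemma outer_legs_sum s k : uniq s -> (forall j, k <= l j)%N ->
  indep_sum z (outer_legs s k) = \prod_(j <- s) path_sum z (l j - k).
Proof.
move=> us le_k; elim: s us => [_|j s IHs /= /andP[js us]].
  rewrite big_nil (_ : outer_legs _ _ = set0) ?indep_sum0 //.
  by apply/setP => -[x|]; rewrite !inE.
rewrite big_cons -IHs // -outer_leg_sum // -indep_sumU.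
- by congr indep_sum; apply/setP => -[x|]; rewrite !inE // -andb_orl.
- rewrite -setI_eq0; apply/eqP/setP => -[x|]; rewrite !inE //=.
  by case: (boolP (tag x \in s)) => xs; rewrite ?andbF //; case: eqP => // xj; rewrite -xj xs in js.
- move=> [x|] [y|]; rewrite !inE //= => /andP[/eqP xj _] /andP[ys _].
  by case: eqP => // xy; rewrite -xj xy ys in js.
Qed.

Lemma spider_sum : (forall j, 0 < l j)%N ->
  (indep_poly (spider l) K).[z]
  = \prod_j path_sum z (l j) + z * \prod_j path_sum z (l j).-1.
Proof.
move=> hl; rewrite indep_polyE (@indep_sum_vertex _ _ _ (None : spider l)) ?inE //.
have -> : [set: spider l] :\ (None : spider l) = outer_legs (index_enum 'I_d) 0.
  by apply/setP => -[x|]; rewrite !inE //= mem_index_enum.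
have -> : [set x in [set: spider l] | (x != None :> spider l) && ~~ adj (None : spider l) x]
          = outer_legs (index_enum 'I_d) 1.
  by apply/setP => -[x|]; rewrite !inE //= mem_index_enum -lt0n.
rewrite !outer_legs_sum ?index_enum_uniq //.
by congr (_ + _ * _); apply: eq_bigr => j _; rewrite ?subn0 ?subn1.
Qed.

End SpiderSum.

(** * Real inequalities behind the double step *)

(** Here u = a + i b, 1 / z = x - i y and n = 1 / |z|.  Then q = |u|^2,
    p = Re (u / z) and M = |1 + u / z|^2, and v = 1 + u / (1 + u / z) satisfies
      M Re v = M + a + q x,  M Im v = b + q y,  M |v|^2 = T.
    The hypothesis b x <= a y says that arg u <= arg z. *)
Section TwoStep.
Variables (R : realFieldType) (a b x y n : R).
Hypotheses (a_ge1 : 1 <= a) (b_ge0 : 0 <= b) (x_ge0 : 0 <= x) (y_ge0 : 0 <= y).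
Hypotheses (n_ge0 : 0 <= n) (nE : n ^+ 2 = x ^+ 2 + y ^+ 2) (sector : b * x <= a * y).

Variables q p M T : R.
Hypotheses (qE : q = a ^+ 2 + b ^+ 2) (pE : p = a * x + b * y).
Hypotheses (ME : M = 1 + p *+ 2 + q * n ^+ 2) (TE : T = M + q + a *+ 2 + (q * x) *+ 2).

Fact two_step_q_ge0 : 0 <= q.
Proof. by rewrite qE addr_ge0 ?sqr_ge0. Qed.
Fact two_step_p_ge0 : 0 <= p.
Proof. by rewrite pE addr_ge0 ?mulr_ge0 // (le_trans ler01). Qed.
Fact two_step_M_ge : 1 + p *+ 2 <= M.
Proof. by rewrite ME lerDl mulr_ge0 ?two_step_q_ge0 ?sqr_ge0. Qed.
Fact two_step_y_le_n : y <= n.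
Proof. by rewrite -(ler_pXn2r (ltn0Sn 1)) ?nnegrE // nE lerDr sqr_ge0. Qed.
(** With D = arg z - arg u, this is sin (arg u) <= cos D, which holds because
    arg u + D = arg z is at most pi / 2. *)
Fact two_step_bn_le_p : b * n <= p.
Proof.
rewrite -(ler_pXn2r (ltn0Sn 1)) ?nnegrE ?mulr_ge0 ?two_step_p_ge0 // exprMn nE pE.
have : 0 <= (b * x) * (a * y - b * x) by rewrite mulr_ge0 ?mulr_ge0 ?subr_ge0.
have : 0 <= (a * x) ^+ 2 by apply: sqr_ge0.
nra.
Qed.
Fact two_step_pb_le : p * b <= q * n.
Proof.
rewrite -(ler_pXn2r (ltn0Sn 1)) ?nnegrE ?mulr_ge0 ?two_step_p_ge0 ?two_step_q_ge0 // !exprMn nE.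
have -> : q ^+ 2 * (x ^+ 2 + y ^+ 2)
  = p ^+ 2 * b ^+ 2 + (q * a ^+ 2 * (x ^+ 2 + y ^+ 2) + b ^+ 2 * (b * x - a * y) ^+ 2).
  by rewrite qE pE; ring.
rewrite lerDl; apply: addr_ge0; last by rewrite mulr_ge0 ?sqr_ge0.
by rewrite -nE mulr_ge0 ?sqr_ge0 // mulr_ge0 ?sqr_ge0 ?two_step_q_ge0.
Qed.

(** In the expansion of M b = b + 2 p b + q n^2 b, the hypothesis takes care of
    b, and the other two terms together with M q y are at most
    n q (M + 2 + p), hence at most 3 n M q. *)
Lemma two_step_tangent : b <= n * a * q *+ 3 ->
  M * (b + q * y) <= n * (M + a + q * x) * T *+ 3.
Proof.
move=> hb; have p0 := two_step_p_ge0; have q0 := two_step_q_ge0; have M1 := two_step_M_ge.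
have yn := two_step_y_le_n; have bnp := two_step_bn_le_p; have pbq := two_step_pb_le.
have a1 := a_ge1; have b0 := b_ge0; have n0 := n_ge0.
have h1 : M * (q * y) <= M * (q * n).
  by apply: ler_wpM2l; [lra | apply: ler_wpM2l].
have h2 : q * n * (b * n) <= q * n * p by apply: ler_wpM2l; rewrite ?mulr_ge0.
have h3 : 0 <= n * q * (M - (1 + p *+ 2)) by rewrite !mulr_ge0 // subr_ge0.
have h4 : 0 <= n * q * p by rewrite !mulr_ge0.
have h5 : n * ((a + M) * q) <= n * ((M + a + q * x) * T).
  have qx : 0 <= q * x by apply: mulr_ge0.
  apply: ler_wpM2l => //; rewrite TE; apply: ler_pM => //; lra.
have E : M * b = b + (p * b) *+ 2 + q * n * (b * n) by rewrite ME; ring.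
nra.
Qed.

(** Expanding M (b + q n)^2 and the lower bound q^3 + 3 q^2 (M + 2 a) of T^3,
    the terms n^2 q^3 are compared by the bound on b^2, and those in a q^2 by the
    bound on b: the total 12 n^2 a q^2 on the left is exactly what the right side
    offers.  The remaining terms are multiples of (q n)^2. *)
Lemma two_step_sine : b <= n * a * q *+ 3 -> b ^+ 2 <= n ^+ 2 * q ^+ 3 *+ 2 ->
  M * (b + q * y) ^+ 2 <= n ^+ 2 * T ^+ 3 *+ 2.
Proof.
move=> hb hs; have p0 := two_step_p_ge0; have q0 := two_step_q_ge0; have M1 := two_step_M_ge.
have yn := two_step_y_le_n; have bnp := two_step_bn_le_p; have pbq := two_step_pb_le.
have a1 := a_ge1; have b0 := b_ge0; have n0 := n_ge0.
have qn : 0 <= q * n by apply: mulr_ge0.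
have h1 : M * (b + q * y) ^+ 2 <= M * (b + q * n) ^+ 2.
  apply: ler_wpM2l; first lra.
  have := ler_wpM2l q0 yn; have := mulr_ge0 q0 y_ge0.
  by move=> ? ?; rewrite ler_sqr ?nnegrE; lra.
have h2 : p * b * b <= q * n * (n * a * q *+ 3).
  by apply: ler_pM; rewrite ?mulr_ge0.
have h3 : q * n ^+ 2 * b ^+ 2 <= q * n ^+ 2 * q.
  by apply: ler_wpM2l; [rewrite mulr_ge0 ?sqr_ge0 | rewrite qE lerDr sqr_ge0].
have h4 : b * (q * n) <= (n * a * q *+ 3) * (q * n) by apply: ler_wpM2r.
have h5 : p * b * (q * n) <= q * n * (q * n) by apply: ler_wpM2r.
have h6 : (q * n) ^+ 2 * (b * n) <= (q * n) ^+ 2 * p.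
  by apply: ler_wpM2l; rewrite ?sqr_ge0.
have h7 : 0 <= (q * n) ^+ 2 * (M - (1 + p *+ 2)).
  by rewrite mulr_ge0 ?sqr_ge0 // subr_ge0.
have h8 : 0 <= (q * n) ^+ 2 * p by rewrite mulr_ge0 ?sqr_ge0.
have h9 : n ^+ 2 * (q ^+ 3 + q ^+ 2 * (M + a *+ 2) *+ 3) <= n ^+ 2 * T ^+ 3.
  apply: ler_wpM2l; first exact: sqr_ge0.
  have qx : 0 <= q * x by apply: mulr_ge0.
  pose t := M + a *+ 2 + (q * x) *+ 2.
  have t_ge0 : 0 <= t by rewrite /t; lra.
  have -> : T = q + t by rewrite TE /t; ring.
  have -> : (q + t) ^+ 3 = q ^+ 3 + q ^+ 2 * t *+ 3 + (q * t ^+ 2 *+ 3 + t ^+ 3).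
    by ring.
  have : q ^+ 2 * (M + a *+ 2) <= q ^+ 2 * t.
    by apply: ler_wpM2l; [exact: sqr_ge0 | rewrite /t; lra].
  have := mulr_ge0 q0 (sqr_ge0 t); have := exprn_ge0 3 t_ge0.
  lra.
have E1 : M * (b + q * n) ^+ 2 = b ^+ 2 + (p * b * b) *+ 2 + q * n ^+ 2 * b ^+ 2
   + (b * (q * n) *+ 2 + (p * b * (q * n)) *+ 4 + (q * n) ^+ 2 * (b * n) *+ 2)
   + M * (q * n) ^+ 2 by rewrite ME; ring.
have h10 : 0 <= (q * n) ^+ 2 by apply: sqr_ge0.
rewrite (le_trans h1) // E1; lra.
Qed.

(** Up to terms that are clearly nonnegative, the difference of the two sides
    is |u - 2 / conj z|^2. *)
Lemma two_step_growth : M * (n ^+ 2 *+ 2 + 3) <= T * (n ^+ 2 *+ 2 + 1).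
Proof.
have q0 := two_step_q_ge0; have a1 := a_ge1; have n2 := sqr_ge0 n.
have h1 : 0 <= q + n ^+ 2 *+ 4 - p *+ 4.
  have -> : q + n ^+ 2 *+ 4 - p *+ 4 = (a - x *+ 2) ^+ 2 + (b - y *+ 2) ^+ 2.
    by rewrite nE qE pE; ring.
  by rewrite addr_ge0 ?sqr_ge0.
have h2 : 0 <= (a - 1) * (n ^+ 2 *+ 2 + 1).
  by rewrite mulr_ge0 ?subr_ge0 // addr_ge0 // mulrn_wge0 // sqr_ge0.
have h3 : 0 <= q * x * (n ^+ 2 *+ 2 + 1).
  by rewrite !mulr_ge0 // addr_ge0 // mulrn_wge0 // sqr_ge0.
rewrite TE ME; lra.
Qed.

End TwoStep.

(** * Products leaving the first quadrant *)

Local Notation Re := complex.Re.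
Local Notation Im := complex.Im.

Section Complex.
Variable R : rcfType.
Implicit Types (u v z : R[i]) (s : seq R[i]).

Lemma normc_sqr u : normc u ^+ 2 = Re u ^+ 2 + Im u ^+ 2.
Proof. by case: u => a b /=; rewrite sqr_sqrtr // addr_ge0 ?sqr_ge0. Qed.

Lemma normc_ge0 u : 0 <= normc u.
Proof. by case: u => a b; rewrite sqrtr_ge0. Qed.

Lemma normc_gt0 u : (0 < normc u) = (u != 0).
Proof.
rewrite lt_def normc_ge0 andbT; congr negb; apply/eqP/eqP => [|->].
  exact: eq0_normc.
exact: normc0.
Qed.

Lemma Re_mul u v : Re (u * v) = Re u * Re v - Im u * Im v.
Proof. by case: u v => [a b] [c d]. Qed.

Lemma Im_mul u v : Im (u * v) = Re u * Im v + Im u * Re v.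
Proof. by case: u v => [a b] [c d]. Qed.

Lemma Re_le_normc u : Re u <= normc u.
Proof.
have [u0|u0] := lerP (Re u) 0; first exact: le_trans u0 (normc_ge0 u).
rewrite -(ler_pXn2r (ltn0Sn 1)) ?nnegrE ?normc_ge0 ?(ltW u0) //.
by rewrite normc_sqr lerDl sqr_ge0.
Qed.

Definition quadrant u := (0 < Re u) && (0 <= Im u).

(** After division by |u| |v|, the sines of the two arguments add up to at least
    1: outside the quadrant cos (arg u) cos (arg v) <= sin (arg u) sin (arg v),
    so that the squares of the sines already add up to 1. *)
Lemma quadrant_exit u v : quadrant u -> quadrant v -> ~~ quadrant (u * v) ->
  normc u * normc v <= Im u * normc v + normc u * Im v.
Proof.
move=> /andP[u1 u2] /andP[v1 v2].
have -> : quadrant (u * v) = (0 < Re (u * v)).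
  rewrite /quadrant Im_mul andb_idr // => _.
  by apply: addr_ge0; apply: mulr_ge0 => //; apply: ltW.
rewrite Re_mul -leNgt subr_le0 => h.
have U := normc_sqr u; have V := normc_sqr v.
have U0 := normc_ge0 u; have V0 := normc_ge0 v.
move: (Re u) (Im u) (Re v) (Im v) (normc u) (normc v) u1 u2 v1 v2 h U V U0 V0.
move=> a b c e r t a0 b0 c0 e0 h rE tE r0 t0.
rewrite -(ler_pXn2r (ltn0Sn 1)) ?nnegrE ?addr_ge0 ?mulr_ge0 //.
have h1 : (a * c) ^+ 2 <= (b * e) ^+ 2.
  by rewrite ler_sqr ?nnegrE ?mulr_ge0 ?(ltW a0) ?(ltW c0).
have h2 : 0 <= b * t * (r * e) by rewrite !mulr_ge0.
rewrite sqrrD !exprMn rE tE.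
rewrite !exprMn in h1.
lra.
Qed.

Lemma first_exit s : all quadrant s -> ~~ quadrant (\prod_(u <- s) u) ->
  exists s1 u s2, [/\ s = s1 ++ u :: s2, quadrant (\prod_(v <- s1) v) &
                      ~~ quadrant ((\prod_(v <- s1) v) * u)].
Proof.
elim/last_ind: s => [|s u IHs].
  by rewrite big_nil /quadrant /= ltr01 lexx.
rewrite all_rcons => /andP[qu qs]; rewrite big_rcons /= => nq.
have [qp|nqp] := boolP (quadrant (\prod_(v <- s) v)).
  by exists s, u, [::]; split; rewrite ?cats1.
have [s1 [v [s2 [-> q1 q2]]]] := IHs qs nqp.
by exists s1, v, (rcons s2 u); split; rewrite // rcons_cat.
Qed.

Lemma normc_prod_ge1 s : all (fun u => 1 <= normc u) s ->
  1 <= normc (\prod_(u <- s) u).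
Proof.
elim: s => [|u s IHs] /=; first by rewrite big_nil normc1.
move=> /andP[hu /IHs hs]; rewrite big_cons normcM.
by rewrite -[leLHS]mulr1 ler_pM.
Qed.

(** sin (arg u) <= (10 / 7) |u|^2 / r.  The constant lies between sqrt 2, which
    the ratios satisfy, and half of the lower bound known for |u|^2 when r > 6:
    sums are dominated by products once |u|^2 is at least twice the constant. *)
Definition slim r u := Im u * r <= normc u ^+ 3 * (10 / 7).

(** Sines of arguments are subadditive, and s + t <= s t / (10 / 7) for s and t
    at least 20 / 7. *)
Lemma slim_prod r s : 0 <= r -> s != [::] ->
  all (fun u => [&& quadrant u, slim r u & 20 / 7 <= normc u ^+ 2]) s ->
  slim r (\prod_(u <- s) u) && (20 / 7 <= normc (\prod_(u <- s) u) ^+ 2).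
Proof.
move=> r0; elim: s => // u s IHs _ /= /andP[/and3P[/andP[u1 u2] cu nu] hs].
have [->|sn0] := eqVneq s [::]; first by rewrite big_seq1 cu.
have /andP[cp np] := IHs sn0 hs; rewrite big_cons; set v := \prod_(v <- s) v in cp np *.
rewrite /slim normcM Im_mul.
have hRv := Re_le_normc v; have hRu := Re_le_normc u.
have := normc_ge0 u; have := normc_ge0 v; move: cu cp nu np; rewrite /slim.
move: (normc u) (normc v) hRu hRv => x y hRu hRv cu cv nx ny y0 x0.
have h1 : Re v * (Im u * r) <= y * (x ^+ 3 * (10 / 7)).
  apply: le_trans (_ : y * (Im u * r) <= _); last exact: ler_wpM2l.
  by apply: ler_wpM2r; rewrite ?mulr_ge0.
have h2 : Re u * (Im v * r) <= x * (y ^+ 3 * (10 / 7)).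
  apply: le_trans (_ : Re u * (y ^+ 3 * (10 / 7)) <= _).
    by apply: ler_wpM2l => //; apply: ltW.
  by apply: ler_wpM2r => //; rewrite mulr_ge0 ?exprn_ge0 // divr_ge0.
have h3 : x ^+ 2 + y ^+ 2 <= x ^+ 2 * y ^+ 2.
  have : 0 <= (x ^+ 2 - 20 / 7) * (y ^+ 2 - 1) by apply: mulr_ge0; lra.
  have : 0 <= (x ^+ 2 - 2) * (y ^+ 2 - 2) by apply: mulr_ge0; lra.
  lra.
have h4 : x * y * (x ^+ 2 + y ^+ 2) <= x * y * (x ^+ 2 * y ^+ 2).
  by apply: ler_wpM2l; rewrite ?mulr_ge0.
apply/andP; split; last by rewrite exprMn; lra.
have -> : (x * y) ^+ 3 = x * y * (x ^+ 2 * y ^+ 2) by ring.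
lra.
Qed.

End Complex.

Arguments quadrant {R} u.

(** * Ratios of consecutive path polynomials *)

Section Ratios.
Variable R : rcfType.
Implicit Types (u v z : R[i]) (s : seq R[i]).

Lemma normcN u : normc (- u) = normc u.
Proof. by case: u => a b /=; rewrite !sqrrN. Qed.

Lemma Re_div z u : Re (z / u) = (Re z * Re u + Im z * Im u) / normc u ^+ 2.
Proof.
rewrite normc_sqr; case: z u => [c e] [a b]; rewrite Re_mul /=.
by rewrite mulrN opprK mulrDl !mulrA.
Qed.

Lemma Im_div z u : Im (z / u) = (Im z * Re u - Re z * Im u) / normc u ^+ 2.
Proof.
rewrite normc_sqr; case: z u => [c e] [a b]; rewrite Im_mul /=.
by rewrite mulrN addrC mulrBl !mulrA.
Qed.

(** The last condition is Im (z * conj u) >= 0: the argument of u does not exceed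
    that of z. *)
Definition wedge z u := [/\ 1 <= Re u, 0 <= Im u & Re z * Im u <= Im z * Re u].

(** tan (arg u) <= 3 |u|^2 / r. *)
Definition tangent_bound r u := Im u * r <= Re u * normc u ^+ 2 *+ 3.

(** The square of sin (arg u) <= sqrt 2 |u|^2 / r. *)
Definition sine_bound r u := (Im u * r) ^+ 2 <= (normc u ^+ 2) ^+ 3 *+ 2.

Definition modulus_bound r u := 2 + r ^+ 2 *+ 3 <= normc u ^+ 2 * (2 + r ^+ 2).

Lemma wedge_neq0 z u : wedge z u -> u != 0.
Proof. by case=> h _ _; apply/eqP => u0; move: h; rewrite u0 /= lt_geF. Qed.

Lemma sine_slim r u : sine_bound r u -> slim r u.
Proof.
rewrite /sine_bound /slim -exprM => h; have u0 := normc_ge0 u.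
have [n0|n0] := lerP (Im u * r) 0.
  by apply: le_trans n0 _; rewrite mulr_ge0 ?exprn_ge0 // divr_ge0.
rewrite -(ler_pXn2r (ltn0Sn 1)) ?nnegrE ?(ltW n0) //; last first.
  by rewrite mulr_ge0 ?exprn_ge0 // divr_ge0.
apply: le_trans h _; have : 0 <= normc u ^+ 6 by apply: exprn_ge0.
have -> : (normc u ^+ 3 * (10 / 7)) ^+ 2 = normc u ^+ 6 * (100 / 49) by field.
by move: (normc u ^+ 6) => t t0; lra.
Qed.

Section FixedPoint.
Variable z : R[i].
Hypotheses (z_neq0 : z != 0) (Rez : 0 <= Re z) (Imz : 0 <= Im z).

(** z / u has argument arg z - arg u, again between 0 and arg z, and adding 1
    turns it towards the positive axis. *)
Lemma wedge_step u : wedge z u -> wedge z (1 + z / u).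
Proof.
move=> wu; have := wedge_neq0 wu; case: wu => a1 b0 h.
rewrite -normc_gt0 => q0.
have a0 : 0 <= Re u by apply: le_trans a1.
have := exprn_gt0 2 q0 => {}q0.
have hRe : Re (1 + z / u) = 1 + Re (z / u) by case: (z / u).
have hIm : Im (1 + z / u) = Im (z / u) by case: (z / u) => x y /=; rewrite add0r.
split; rewrite ?hRe ?hIm ?Re_div ?Im_div.
- by rewrite lerDl divr_ge0 ?(ltW q0) // addr_ge0 ?mulr_ge0.
- by rewrite divr_ge0 ?(ltW q0) // subr_ge0.
rewrite mulrDr mulr1 !mulrA -subr_ge0 -addrA -mulrBl addr_ge0 // divr_ge0 ?(ltW q0) //.
have -> : Im z * (Re z * Re u + Im z * Im u) - Re z * (Im z * Re u - Re z * Im u)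
   = (Im z ^+ 2 + Re z ^+ 2) * Im u by ring.
by apply: mulr_ge0 => //; apply: addr_ge0; apply: sqr_ge0.
Qed.

(** The crude bound Re u >= 1 is enough to give the image the modulus bound, so
    only the other two bounds are passed on from u. *)
Lemma two_step_bounds u (v := 1 + z / (1 + z / u)) (r := normc z) : wedge z u ->
  [/\ tangent_bound r u -> tangent_bound r v,
      tangent_bound r u -> sine_bound r u -> sine_bound r v
    & modulus_bound r v].
Proof.
move=> wu; have u_neq0 := wedge_neq0 wu; have wu' := wedge_neq0 (wedge_step wu).
have r0 : 0 < r by rewrite normc_gt0.
case: wu => a1 b0 hw.
pose x := Re z / r ^+ 2; pose y := Im z / r ^+ 2; pose n := r^-1.
have r20 : 0 < r ^+ 2 by apply: exprn_gt0.
have nE : n ^+ 2 = x ^+ 2 + y ^+ 2.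
  rewrite /x /y !expr_div_n -mulrDl -normc_sqr -/r /n.
  by field; rewrite gt_eqF.
have x0 : 0 <= x by rewrite divr_ge0 ?(ltW r20).
have y0 : 0 <= y by rewrite divr_ge0 ?(ltW r20).
have n0 : 0 <= n by rewrite invr_ge0 (ltW r0).
have hs : Im u * x <= Re u * y.
  by rewrite !mulrA ler_pM2r ?invr_gt0 // mulrC [leRHS]mulrC.
pose q := normc u ^+ 2; have qE : q = Re u ^+ 2 + Im u ^+ 2 := normc_sqr u.
pose p := Re u * x + Im u * y; have pE : p = Re u * x + Im u * y by [].
pose M := 1 + p *+ 2 + q * n ^+ 2; have ME : M = 1 + p *+ 2 + q * n ^+ 2 by [].
pose A := Re u + q * x; pose B := Im u + q * y.
pose T := M + q + Re u *+ 2 + (q * x) *+ 2.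
have TE : T = M + q + Re u *+ 2 + (q * x) *+ 2 by [].
have M0 : 0 < M.
  have := two_step_M_ge qE ME; have := two_step_p_ge0 a1 b0 x0 y0 pE.
  by move: (p) (M) => p' M'; lra.
have M_neq0 : M != 0 by rewrite gt_eqF.
have vE : v = 1 + Complex (A / M) (B / M).
  congr (_ + _).
  have -> : z / (1 + z / u) = u / (1 + u / z).
    have e1 : u + z != 0.
      have -> : u + z = u * (1 + z / u) by rewrite mulrDr mulr1 mulrCA divff ?mulr1.
      by rewrite mulf_neq0.
    by field; rewrite z_neq0 u_neq0 ?e1 addrC e1.
  have -> : 1 + u / z = Complex (1 + p) (Im u * x - Re u * y).
    apply/eqP; rewrite eq_complex.
    have -> : Re (1 + u / z) = 1 + Re (u / z) by case: (u / z).
    have -> : Im (1 + u / z) = Im (u / z) by case: (u / z) => ? ? /=; rewrite add0r.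
    rewrite Re_div Im_div /= -/r /p /x /y.
    by apply/andP; split; apply/eqP; field; rewrite gt_eqF.
  have ME' : M = (1 + p) ^+ 2 + (Im u * x - Re u * y) ^+ 2.
    by rewrite ME nE qE pE; ring.
  apply/eqP; rewrite eq_complex Re_div Im_div normc_sqr /= -ME' /A /B qE.
  by apply/andP; split; apply/eqP; congr (_ / _); rewrite pE; ring.
have Rev : Re v = (M + Re u + q * x) / M.
  by rewrite vE /= -[in LHS](divff M_neq0) -mulrDl addrA.
have Imv : Im v = B / M by rewrite vE /= add0r.
have normv : normc v ^+ 2 = T / M.
  rewrite normc_sqr Rev Imv !expr_div_n -mulrDl.
  have -> : (M + Re u + q * x) ^+ 2 + B ^+ 2 = T * M.
    by rewrite /B TE ME nE qE pE; ring.
  by field.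
have nr : n * r = 1 by rewrite mulVf // gt_eqF.
have n2r : n ^+ 2 * r ^+ 2 = 1 by rewrite -exprMn nr expr1n.
have hn : Im u * r <= Re u * q *+ 3 -> Im u <= n * Re u * q *+ 3.
  have -> : n * Re u * q *+ 3 = (Re u * q *+ 3) / r by rewrite /n; ring.
  by rewrite ler_pdivlMr.
split.
- rewrite /tangent_bound Rev Imv normv => /hn ht.
  have := two_step_tangent a1 b0 x0 y0 n0 nE hs qE pE ME TE ht.
  rewrite -/B => /(ler_wpM2r (ltW r0)).
  have -> : n * (M + Re u + q * x) * T *+ 3 * r
     = (n * r) * ((M + Re u + q * x) * T *+ 3) by ring.
  rewrite nr mul1r => h.
  have -> : B / M * r = (M * B * r) / M ^+ 2 by field.
  have -> : (M + Re u + q * x) / M * (T / M) *+ 3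
     = ((M + Re u + q * x) * T *+ 3) / M ^+ 2 by field.
  by rewrite ler_pM2r // invr_gt0 exprn_gt0.
- rewrite /tangent_bound /sine_bound Imv normv => /hn ht hsin.
  have hs' : Im u ^+ 2 <= n ^+ 2 * q ^+ 3 *+ 2.
    have -> : n ^+ 2 * q ^+ 3 *+ 2 = (q ^+ 3 *+ 2) / r ^+ 2.
      by rewrite /n; field; rewrite gt_eqF.
    by rewrite ler_pdivlMr // -exprMn.
  have := two_step_sine a1 b0 x0 y0 n0 nE hs qE pE ME TE ht hs'.
  rewrite -/B => /(ler_wpM2r (ltW r20)).
  have -> : n ^+ 2 * T ^+ 3 *+ 2 * r ^+ 2 = (n ^+ 2 * r ^+ 2) * (T ^+ 3 *+ 2) by ring.
  rewrite n2r mul1r => h.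
  have -> : (B / M * r) ^+ 2 = (M * B ^+ 2 * r ^+ 2) / M ^+ 3 by field.
  have -> : (T / M) ^+ 3 *+ 2 = (T ^+ 3 *+ 2) / M ^+ 3 by field.
  by rewrite ler_pM2r // invr_gt0 exprn_gt0.
have := two_step_growth a1 x0 nE qE pE ME TE.
move=> /(ler_wpM2r (ltW r20)).
have -> : M * (n ^+ 2 *+ 2 + 3) * r ^+ 2 = M * ((n ^+ 2 * r ^+ 2) *+ 2 + r ^+ 2 *+ 3).
  by ring.
have -> : T * (n ^+ 2 *+ 2 + 1) * r ^+ 2 = T * ((n ^+ 2 * r ^+ 2) *+ 2 + r ^+ 2).
  by ring.
rewrite n2r /modulus_bound normv => h.
have -> : T / M * (2 + r ^+ 2) = (T * (2 + r ^+ 2)) / M by ring.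
by rewrite ler_pdivlMr // mulrC.
Qed.

Fixpoint path_ratio n : R[i] := if n is m.+1 then 1 + z / path_ratio m else 1.

Lemma path_ratio_wedge n : wedge z (path_ratio n).
Proof.
elim: n => [|n IHn]; last exact: wedge_step.
by split; rewrite /= ?mulr0 ?mulr1.
Qed.

(** At n = 0 the ratio is the real number 1, and at n = 1 it is 1 + z; from
    there each parity class follows the double step. *)
Lemma path_ratio_bounds n : [/\ tangent_bound (normc z) (path_ratio n),
  sine_bound (normc z) (path_ratio n)
  & (0 < n)%N -> modulus_bound (normc z) (path_ratio n)].
Proof.
(* Consecutive indices are treated together, as the step has length 2. *)
suff h m : [/\ tangent_bound (normc z) (path_ratio m),
               sine_bound (normc z) (path_ratio m),
               tangent_bound (normc z) (path_ratio m.+1),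
               sine_bound (normc z) (path_ratio m.+1)
               & modulus_bound (normc z) (path_ratio m.+1)].
  by case: n => [|n]; [case: (h 0) | case: (h n)].
elim: m => [|m [t0 s0 t1 s1 b1]]; last first.
  by have [/(_ t0) t2 /(_ t0 s0) s2 b2] := two_step_bounds (path_ratio_wedge m).
have c0 := Rez; have r0 := normc_ge0 z; have zr := normc_sqr z.
have zE : Im z <= normc z.
  by rewrite -(ler_pXn2r (ltn0Sn 1)) ?nnegrE // zr lerDr sqr_ge0.
have u1 : normc (1 + z / 1) ^+ 2 = 1 + Re z *+ 2 + normc z ^+ 2.
  by rewrite divr1 normc_sqr zr; case: (z) => a b /=; ring.
have Re1 : Re (1 + z / 1) = 1 + Re z by rewrite divr1; case: (z).
have Im1 : Im (1 + z / 1) = Im z by rewrite divr1; case: (z) => ? ? /=; rewrite add0r.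
have t_ge0 := sqr_ge0 (normc z).
have h : Im z * normc z <= normc z ^+ 2 by apply: ler_wpM2r.
have hq : 1 + normc z ^+ 2 <= 1 + Re z *+ 2 + normc z ^+ 2 by lra.
split.
- by rewrite /tangent_bound /path_ratio normc1 expr1n mulr1 mul0r mulrn_wge0.
- by rewrite /sine_bound /path_ratio normc1 !expr1n mul0r expr0n mulrn_wge0.
- rewrite /tangent_bound /path_ratio u1 Re1 Im1.
  have := mulr_ge0 Rez t_ge0; have := mulr_ge0 Rez Rez; lra.
- rewrite /sine_bound /path_ratio u1 Im1.
  have h2 : (Im z * normc z) ^+ 2 <= (normc z ^+ 2) ^+ 2.
    by rewrite ler_sqr ?nnegrE ?mulr_ge0.
  have h3 : (1 + normc z ^+ 2) ^+ 3 <= (1 + Re z *+ 2 + normc z ^+ 2) ^+ 3.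
    by apply: lerXn2r; rewrite ?nnegrE //; lra.
  apply: le_trans h2 _.
  move: (normc z ^+ 2) t_ge0 h3 => t t0 h3.
  have := exprn_ge0 3 t0; have := sqr_ge0 t; lra.
rewrite /modulus_bound /path_ratio u1.
have := mulr_ge0 Rez t_ge0; have := sqr_ge0 (normc z ^+ 2); lra.
Qed.

Lemma path_sum_ratio n : path_sum z n.+1 = path_ratio n.+1 * path_sum z n.
Proof.
elim: n => [|n IHn]; first by rewrite /= divr1 mulr1.
rewrite path_sumSS.
have := wedge_neq0 (path_ratio_wedge n.+1); set u := path_ratio n.+1 in IHn * => u0.
have -> : path_ratio n.+2 = 1 + z / u by [].
by rewrite mulrDl mul1r; congr (_ + _); rewrite IHn -mulrA mulKf.
Qed.

Lemma path_sum_neq0 n : path_sum z n != 0.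
Proof.
elim: n => [|n IHn]; first exact: oner_neq0.
by rewrite path_sum_ratio mulf_neq0 // (wedge_neq0 (path_ratio_wedge _)).
Qed.


End FixedPoint.
End Ratios.

(** * Two exits from the quadrant *)

Section Crossing.
Variables (R : rcfType) (z : R[i]).
Hypotheses (z_neq0 : z != 0) (Rez : 0 <= Re z) (Imz : 0 <= Im z).
Local Notation r := (normc z).

Definition admissible u :=
  [&& quadrant u, 1 <= normc u, normc u ^+ 2 * (2 + r ^+ 2) >= 2 + r ^+ 2 *+ 3
    & slim r u].

(** Only the factors up to the first exit matter, as all moduli are at least 1.
    For r <= 6 the last factor u and the product P of those before it both have
    squared modulus at least k = (2 + 3 r^2) / (2 + r^2), and k^2 > r; for r > 6
    one has k > 20 / 7 and the sines decide. *)
Lemma exit_normc_sqr s : all admissible s ->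
  ~~ quadrant (\prod_(u <- s) u) -> r < normc (\prod_(u <- s) u) ^+ 2.
Proof.
move=> ad_s nq.
have qs : all quadrant s by apply: sub_all ad_s => u /and4P[].
have [s1 [u [s2 [sE q1 nq1]]]] := first_exit qs nq.
move: ad_s; rewrite sE all_cat /= => /and3P[ad1 adu ad2].
have [qu nu ku su] := and4P adu.
have s1_neq0 : s1 != [::] by apply: contraNneq nq1 => ->; rewrite big_nil mul1r.
have n2 : 1 <= normc (\prod_(v <- s2) v).
  by apply: normc_prod_ge1; apply: sub_all ad2 => v /and4P[].
rewrite big_cat big_cons /= !normcM mulrA.
set P := \prod_(v <- s1) v in q1 nq1 *.
have r0 : 0 < r by rewrite normc_gt0.
have P0 : 0 < normc P.
  by rewrite normc_gt0; apply: contraTneq q1 => ->; rewrite /quadrant /= ltxx.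
have u0 : 0 < normc u by apply: lt_le_trans nu.
suff h : r < (normc P * normc u) ^+ 2.
  apply: lt_le_trans h _.
  by rewrite [leRHS]exprMn ler_peMr ?exprn_ege1 ?sqr_ge0.
have r2 : 0 < 2 + r ^+ 2 by have := sqr_ge0 r; lra.
have [r_le6|r_gt6] := lerP r 6.
  have kP : 2 + r ^+ 2 *+ 3 <= normc P ^+ 2 * (2 + r ^+ 2).
    rewrite /P; case: (s1) s1_neq0 ad1 => // v s' _ /= /andP[/and4P[_ _ kv _] ad'].
    rewrite big_cons normcM; apply: le_trans kv _.
    rewrite ler_pM2r // [leRHS]exprMn ler_peMr ?sqr_ge0 // exprn_ege1 //.
    by apply: normc_prod_ge1; apply: sub_all ad' => w /and4P[].
  rewrite -(ltr_pM2r (exprn_gt0 2 r2)).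
  have -> : (normc P * normc u) ^+ 2 * (2 + r ^+ 2) ^+ 2
    = (normc P ^+ 2 * (2 + r ^+ 2)) * (normc u ^+ 2 * (2 + r ^+ 2)) by ring.
  have h0 : 0 <= 2 + r ^+ 2 *+ 3 by have := sqr_ge0 r; lra.
  apply: lt_le_trans (ler_pM h0 h0 kP ku).
  (* (2 + 3 t^2)^2 - t (2 + t^2)^2 is a positive combination of the terms below. *)
  move: r0 r_le6; move: (r) => t t0 t6.
  have : 0 <= t ^+ 4 * (6 - t) by rewrite mulr_ge0 ?exprn_ge0 ?(ltW t0) // subr_ge0.
  have : 0 <= t ^+ 2 * (t *+ 3 - 2) ^+ 2 by rewrite mulr_ge0 ?sqr_ge0.
  have : 0 <= (t - 2) ^+ 2 by apply: sqr_ge0.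
  have : 0 < t ^+ 2 by rewrite exprn_gt0.
  lra.
(* (2 + 3 r^2) / (2 + r^2) > 20 / 7 amounts to r^2 > 26. *)
have k2 v : admissible v -> 20 / 7 < normc v ^+ 2.
  case/and4P=> _ _ kv _; rewrite -(ltr_pM2r r2); apply: lt_le_trans kv.
  have : 36 < r ^+ 2 by rewrite (_ : 36 = 6 ^+ 2) ?ltr_sqr ?nnegrE ?(ltW r0) //; ring.
  by move: (r ^+ 2) => t; lra.
have sl1 : all (fun v => [&& quadrant v, slim r v & 20 / 7 <= normc v ^+ 2]) s1.
  apply: sub_all ad1 => v adv; rewrite (ltW (k2 v adv)) andbT.
  by have [-> _ _] := and4P adv.
have /andP[slP nP] := slim_prod (ltW r0) s1_neq0 sl1.
have := quadrant_exit q1 qu nq1; rewrite -/P in slP nP.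
have /k2 nu2 := adu.
move=> /(ler_wpM2r (ltW r0)).
have : Im P * r * normc u <= normc P ^+ 3 * (10 / 7) * normc u.
  by apply: ler_wpM2r => //; apply: ltW.
have : Im u * r * normc P <= normc u ^+ 3 * (10 / 7) * normc P.
  by apply: ler_wpM2r => //; apply: ltW.
move: P0 u0 nP nu2; move: (normc P) (normc u) (Im P) (Im u) => a b c e a0 b0 na nb h1 h2 h3.
have h4 : r * (a * b) <= ((a ^+ 2 + b ^+ 2) * (10 / 7)) * (a * b) by lra.
rewrite ler_pM2r ?mulr_gt0 // in h4.
apply: le_lt_trans h4 _; rewrite exprMn.
have : 0 <= (a ^+ 2 - 20 / 7) * (b ^+ 2 - 10 / 7) by apply: mulr_ge0; lra.
lra.
Qed.

(** If the factors after the first exit stayed in the quadrant, then P Q, with P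
    and Q the products before and after the exiting factor u, would have an
    argument in [0, pi), whereas P Q = - z / u has one in [pi, 3 pi / 2]. *)
Lemma prod_admissible_neq s :
  all admissible s -> {in s, forall u, wedge z u} -> \prod_(u <- s) u != - z.
Proof.
move=> ad_s wd_s; apply/eqP => sz.
have qs : all quadrant s by apply: sub_all ad_s => u /and4P[].
have nq : ~~ quadrant (\prod_(u <- s) u).
  by rewrite sz /quadrant negb_and -leNgt; case: (z) Rez => a b /= a0; rewrite oppr_le0 a0.
have [s1 [u [s2 [sE q1 nq1]]]] := first_exit qs nq.
have wu : wedge z u by apply: wd_s; rewrite sE mem_cat mem_head orbT.
move: ad_s sz; rewrite sE all_cat /= => /and3P[ad1 adu ad2].
rewrite big_cat big_cons /=; set P := \prod_(v <- s1) v in q1 nq1 *.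
set Q := \prod_(v <- s2) v => sz.
have nq2 : ~~ quadrant Q.
  apply/negP => q2.
  have /(congr1 (@complex.Re R)) := sz; have /(congr1 (@complex.Im R)) := sz.
  have -> : P * (u * Q) = (P * Q) * u by ring.
  rewrite Re_mul Im_mul.
  have -> : Re (- z) = - Re z by case: (z).
  have -> : Im (- z) = - Im z by case: (z).
  case/andP: q1 => P1 P2; case/andP: q2 => Q1 Q2.
  have hI : 0 <= Im (P * Q).
    by rewrite Im_mul; apply: addr_ge0; apply: mulr_ge0 => //; apply: ltW.
  have hIR : 0 < Re (P * Q) \/ 0 < Im (P * Q).
    have [|h] := ltrP 0 (Re (P * Q)); [by left | right].
    rewrite lt_def hI andbT; apply: contraTneq h; rewrite Im_mul Re_mul -ltNge.
    move=> /eqP; rewrite paddr_eq0 ?mulr_ge0 ?(ltW P1) ?(ltW Q1) //.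
    rewrite !mulf_eq0 (gt_eqF P1) (gt_eqF Q1) /= orbF => /andP[_ /eqP ->].
    by rewrite mul0r subr0 mulr_gt0.
  case: wu => a1 b0 hw.
  move: (Re (P * Q)) (Im (P * Q)) hI hIR => X Y Y0 hXY eI eR.
  have a0 : 0 < Re u by apply: lt_le_trans a1.
  (* eR and eI say that (X + i Y) u = - z, where X + i Y = P Q. *)
  have [X0|X0] := ltrP 0 X.
    have h1 : 0 <= X * Im u by rewrite mulr_ge0 ?(ltW X0).
    have h2 : 0 <= Y * Re u by rewrite mulr_ge0 ?(ltW a0).
    have h3 : 0 < X * Re u by rewrite mulr_gt0.
    have Y_eq0 : Y = 0.
      apply/eqP; have : Y * Re u == 0 by have := Imz; rewrite eq_le h2 andbT; lra.
      by rewrite mulf_eq0 (gt_eqF a0) orbF.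
    by move: eR; rewrite Y_eq0 mul0r subr0 => eR; have := Rez; lra.
  have Y1 : 0 < Y by case: hXY => //; rewrite ltNge X0.
  have : 0 < Y * (Re u ^+ 2 + Im u ^+ 2).
    by rewrite mulr_gt0 // ltr_pwDl ?exprn_gt0 ?sqr_ge0.
  (* Y |u|^2 is the imaginary part of - z * conj u. *)
  have -> : Y * (Re u ^+ 2 + Im u ^+ 2)
    = (X * Im u + Y * Re u) * Re u - (X * Re u - Y * Im u) * Im u by ring.
  by rewrite eI eR; lra.
have h1 : r < normc (P * u) ^+ 2.
  have -> : P * u = \prod_(v <- rcons s1 u) v by rewrite big_rcons.
  by apply: exit_normc_sqr; rewrite ?all_rcons ?adu // big_rcons.
have h2 : r < normc Q ^+ 2 := exit_normc_sqr ad2 nq2.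
have := ltr_pM (normc_ge0 z) (normc_ge0 z) h1 h2.
by rewrite -exprMn -(normcM _ Q) -mulrA sz normcN expr2 ltxx.
Qed.

Lemma admissible_ratio n : (0 < n)%N -> admissible (path_ratio z n).
Proof.
move=> n0; have wd := path_ratio_wedge Rez Imz n; have u0 := wedge_neq0 wd.
have [_ sn /(_ n0) mn] := path_ratio_bounds z_neq0 Rez Imz n.
have [a1 b0 _] := wd.
apply/and4P; split=> //; last exact: sine_slim.
  by rewrite /quadrant b0 (lt_le_trans ltr01).
exact: le_trans a1 (Re_le_normc _).
Qed.

Lemma spider_form_neq0 d (l : 'I_d -> nat) : (forall j, 0 < l j)%N ->
  \prod_j path_sum z (l j) + z * \prod_j path_sum z (l j).-1 != 0.
Proof.
move=> hl.
have -> : \prod_j path_sum z (l j) = \prod_j path_ratio z (l j) * \prod_j path_sum z (l j).-1.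
  rewrite -big_split; apply: eq_bigr => j _ /=.
  by case: (l j) (hl j) => // n _; apply: path_sum_ratio.
rewrite -mulrDl mulf_neq0 //; last first.
  by apply/prodf_neq0 => j _; apply: path_sum_neq0.
rewrite addr_eq0 -(big_map (fun j => path_ratio z (l j)) predT id).
apply: prod_admissible_neq.
  by apply/allP => _ /mapP[j _ ->]; apply: admissible_ratio.
by move=> _ /mapP[j _ ->]; apply: path_ratio_wedge.
Qed.

End Crossing.

Lemma spider_neq0 (R : rcfType) d (l : 'I_d -> nat) (z : R[i]) :
  (forall j, 0 < l j)%N -> 0 <= Re z -> (indep_poly (spider l) R[i]).[z] != 0.
Proof.
move=> hl; wlog Imz : z / 0 <= Im z => [hwlog|] Rez.
  have [|Imz] := lerP 0 (Im z); first by move/hwlog; apply.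
  have pJ : map_poly conjc (indep_poly (spider l) R[i]) = indep_poly (spider l) R[i].
    rewrite /indep_poly rmorph_sum /=; apply: eq_bigr => k _.
    by rewrite map_polyZ map_polyXn rmorph_nat.
  rewrite -rootE -pJ complex_root_conj rootE; apply: hwlog; first by
    case: (z) Imz => a b /= b0; rewrite oppr_ge0 ltW.
  by case: (z) Rez.
rewrite spider_sum //; have [->|z_neq0] := eqVneq z 0; last exact: spider_form_neq0.
rewrite mul0r addr0 big1 ?oner_neq0 // => j _.
case: (l j) => // n; elim: n => [|n IHn]; first exact: addr0.
by rewrite path_sumSS mul0r addr0.
Qed.

Theorem theorem4 (R : realType) (d : nat) (l : 'I_d -> nat)
    (hd : (1 <= d)%N) (hl : forall j : 'I_d, (0 < l j)%N) :
  (forall z : R[i], 0 <= complex.Re z ->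
     (indep_poly (spider l) R[i]).[z] != 0) /\
  (forall z : R[i], root (indep_poly (spider l) R[i]) z -> complex.Re z < 0) /\
  stable_graph R (spider l).
Proof.
have nz (z : R[i]) : 0 <= complex.Re z -> (indep_poly (spider l) R[i]).[z] != 0.
  exact: spider_neq0.
have neg (z : R[i]) : root (indep_poly (spider l) R[i]) z -> complex.Re z < 0.
  by rewrite ltNge => /rootP pz; apply/negP => /nz; rewrite pz eqxx.
by split=> //; split=> // z /neg /ltW.
Qed.
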